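(* Assume Assumptions A, B and C hold (with constants $L_\phi,G,V>0$), and let $w^{(t)}$, $0\le t\le T$, be generated by Algorithm 1, where $T=\beta/\varepsilon$ for a constant $\beta>0$ (assumed to be an integer). Let $\eta^{(t)}=D\sqrt{\varepsilon}$ for some $D>0$, and let the learning rates be $\alpha_i^{(t)}=(1+\varepsilon)^t\alpha_i^{(0)}$ with $\alpha_i^{(0)}=\frac{\alpha}{e^{\beta}L_\phi}$ for some $\alpha\in(0,\tfrac13)$. Then $$\frac1T\sum_{t=0}^{T-1}[F(w^{(t)})-F_*]\le \frac{e^{\beta}L_\phi(1+\varepsilon)}{2(1-3\alpha)\alpha\beta}\cdot\frac1n\sum_{i=1}^n\|h(w^{(0)};i)-h_i^*\|^2\cdot\varepsilon+\frac{e^{\beta}L_\phi(3\varepsilon+2)}{8\alpha(1-3\alpha)}\Big[c\big(4+(V+2)GD^2\big)^2+8+4V\Big]\cdot\varepsilon.$$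
   Context: Let $n,c,d$ be positive integers and $[n]=\{1,\dots,n\}$. For each $i\in[n]$ let $h(\cdot;i):\mathbb{R}^d\to\mathbb{R}^c$ (components $h_j(\cdot;i)$, $j\in[c]$) and $\phi_i:\mathbb{R}^c\to\mathbb{R}$. Put $f(w;i)=\phi_i(h(w;i))$, $F(w)=\frac1n\sum_{i=1}^n f(w;i)$ and $F_*=\inf_{w\in\mathbb{R}^d}F(w)$. Each $\phi_i$ is assumed to attain its minimum, and $h_i^*\in\arg\min_{z}\phi_i(z)$. Vector norms are Euclidean; matrix norms are operator (spectral) norms. Assumption A: each $\phi_i$ is convex, bounded below, and $L_\phi$-smooth, i.e. $\|\nabla\phi_i(z_1)-\nabla\phi_i(z_2)\|\le L_\phi\|z_1-z_2\|$ for all $z_1,z_2$. Assumption B: each $h(\cdot;i)$ is twice continuously differentiable and there is $G>0$ with $\|\nabla_w^2 h_j(w;i)\|\le G$ for all $w\in\mathbb{R}^d$, $i\in[n]$, $j\in[c]$. Iteration setup: given a tolerance $\varepsilon>0$, step sizes $\eta^{(t)}>0$, learning rates $\alpha_i^{(t)}>0$ and iterates $w^{(t)}$, let $H_i^{(t)}\in\mathbb{R}^{c\times d}$ be the Jacobian of $h(\cdot;i)$ at $w^{(t)}$, let $\Phi^{(t)}(v)=\frac{1}{2n}\sum_{i=1}^n\|\eta^{(t)}H_i^{(t)}v-\alpha_i^{(t)}\nabla\phi_i(h(w^{(t)};i))\|^2$, $\Psi^{(t)}(v)=\Phi^{(t)}(v)+\frac{\varepsilon^2}{2}\|v\|^2$,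 and let $v_{*\mathrm{reg}}^{(t)}$ be the unique minimizer of $\Psi^{(t)}$ over $\mathbb{R}^d$. Algorithm 1: choose $w^{(0)}\in\mathbb{R}^d$; for $t=0,\dots,T-1$ set $v^{(t)}=v_{*\mathrm{reg}}^{(t)}$ and $w^{(t+1)}=w^{(t)}-\eta^{(t)}v^{(t)}$. Assumption C (constant $V>0$): for each $0\le t<T$ there exists $\hat v^{(t)}\in\mathbb{R}^d$ with $\|\hat v^{(t)}\|^2\le V$ and $\Phi^{(t)}(\hat v^{(t)})\le\varepsilon^2$. *)

(* Defs.v *)
From HB Require Import structures.
From mathcomp Require Import all_boot all_order all_algebra.
From mathcomp Require Import all_classical all_reals all_analysis.
Set Implicit Arguments. Unset Strict Implicit. Unset Printing Implicit Defensive.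
Import Order.TTheory GRing.Theory Num.Theory.
Import numFieldNormedType.Exports.
Local Open Scope classical_set_scope.
Local Open Scope ring_scope.

Section Defs.
Variable R : realType.

(* Euclidean norm of a row vector (the library norm on 'rV is the max norm). *)
Definition vnorm (k : nat) (x : 'rV[R]_k) : R := Num.sqrt (\sum_(l < k) x 0 l ^+ 2).

Definition opnorm (m k : nat) (A : 'M[R]_(m, k)) : R :=
  sup [set vnorm (A *m u^T)^T | u in [set u : 'rV[R]_k | vnorm u <= 1]].

Definition grad (k : nat) (f : 'rV[R]_k -> R) (x : 'rV[R]_k) : 'rV[R]_k :=
  \row_(l < k) ('d f x) (delta_mx 0 l).

Definition compo (k m : nat) (f : 'rV[R]_k -> 'rV[R]_m) (j : 'I_m) : 'rV[R]_k -> R :=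
  fun x => f x 0 j.

Definition hessian (k : nat) (f : 'rV[R]_k -> R) (x : 'rV[R]_k) : 'M[R]_k :=
  'J (grad f) x.

Definition C2 (k m : nat) (f : 'rV[R]_k -> 'rV[R]_m) : Prop :=
  (forall x, differentiable f x) /\
  forall j : 'I_m, (forall x, differentiable (compo f j) x) /\
                   (forall x, differentiable (grad (compo f j)) x) /\
                   continuous (hessian (compo f j)).

Definition convex_fun (k : nat) (f : 'rV[R]_k -> R) : Prop :=
  forall (x y : 'rV[R]_k) (l : R), 0 <= l <= 1 ->
    f (l *: x + (1 - l) *: y) <= l * f x + (1 - l) * f y.

Definition bounded_below (k : nat) (f : 'rV[R]_k -> R) : Prop :=
  exists m : R, forall x, m <= f x.

Definition smooth (k : nat) (L : R) (f : 'rV[R]_k -> R) : Prop :=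
  (forall x, differentiable f x) /\
  forall x y, vnorm (grad f x - grad f y) <= L * vnorm (x - y).

Variables (n c d : nat).

Definition Fobj (h : 'I_n -> 'rV[R]_d -> 'rV[R]_c) (phi : 'I_n -> 'rV[R]_c -> R)
  (w : 'rV[R]_d) : R := n%:R^-1 * \sum_(i < n) phi i (h i w).

Definition Fstar h phi : R := inf (range (Fobj h phi)).

(* Phi^{(t)}(v), with w^{(t)} = wt, eta^{(t)} = eta, alpha_i^{(t)} = alf i;
   H_i^{(t)} v is written v *m 'J (h i) wt in row-vector convention. *)
Definition Phi (h : 'I_n -> 'rV[R]_d -> 'rV[R]_c) (phi : 'I_n -> 'rV[R]_c -> R)
  (eta : R) (alf : 'I_n -> R) (wt v : 'rV[R]_d) : R :=
  (2 * n%:R)^-1 * \sum_(i < n)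
     vnorm (eta *: (v *m 'J (h i) wt) - alf i *: grad (phi i) (h i wt)) ^+ 2.

Definition Psi h phi eta alf wt (eps : R) (v : 'rV[R]_d) : R :=
  Phi h phi eta alf wt v + eps ^+ 2 / 2 * vnorm v ^+ 2.

End Defs.

(* Main.v *)
Require Import Defs.
From HB Require Import structures.
From mathcomp Require Import all_boot all_order all_algebra.
From mathcomp Require Import all_classical all_reals all_analysis.
From mathcomp Require Import ring lra.
Import Order.TTheory GRing.Theory Num.Theory.
Import numFieldNormedType.Exports.
Local Open Scope classical_set_scope.
Local Open Scope ring_scope.

(** Write [e i] for the deviation of [h i (w t.+1)] from the exact gradient step
    [h i (w t) - a *: grad (phi i) (h i (w t))] on [phi i].  Minimality of
    [v t] for [Psi] together with the second-order Taylor bound for [h i] makes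
    the average of [vnorm (e i) ^+ 2] of order [eps ^+ 2].  A convex
    [L]-smooth function satisfies [|grad f x|^2 <= 4 L (f x - min f)], so an
    exact gradient step brings [h i] closer to [hstar i] by an amount
    proportional to the optimality gap; Young's inequality with weight [eps]
    absorbs [e i] at the price of a factor [1 + eps].  The growth
    [(1 + eps) ^+ t] of the learning rates is chosen so that dividing by this
    factor makes the recursion telescope. *)

(** * Euclidean geometry of row vectors and the operator norm *)

Section Euclidean.
Context {R : realType}.
Implicit Types k : nat.

Definition dotv {k} (x y : 'rV[R]_k) : R := \sum_(l < k) x 0 l * y 0 l.

Lemma vnorm_ge0 {k} (x : 'rV[R]_k) : 0 <= vnorm x.
Proof. exact: sqrtr_ge0. Qed.

Lemma vnorm_sqr {k} (x : 'rV[R]_k) : vnorm x ^+ 2 = \sum_(l < k) x 0 l ^+ 2.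
Proof. by rewrite sqr_sqrtr// sumr_ge0// => l _; rewrite sqr_ge0. Qed.

Lemma dotvv {k} (x : 'rV[R]_k) : dotv x x = vnorm x ^+ 2.
Proof. by rewrite vnorm_sqr. Qed.

Lemma dotvC {k} (x y : 'rV[R]_k) : dotv x y = dotv y x.
Proof. by apply: eq_bigr => l _; rewrite mulrC. Qed.

Lemma dotvDl {k} (x y z : 'rV[R]_k) : dotv (x + y) z = dotv x z + dotv y z.
Proof. by rewrite -big_split; apply: eq_bigr => l _; rewrite mxE mulrDl. Qed.

Lemma dotvZl {k} (a : R) (x z : 'rV[R]_k) : dotv (a *: x) z = a * dotv x z.
Proof. by rewrite mulr_sumr; apply: eq_bigr => l _; rewrite mxE mulrA. Qed.

Lemma dotvDr {k} (x y z : 'rV[R]_k) : dotv z (x + y) = dotv z x + dotv z y.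
Proof. by rewrite dotvC dotvDl !(dotvC z). Qed.

Lemma dotvZr {k} (a : R) (x z : 'rV[R]_k) : dotv z (a *: x) = a * dotv z x.
Proof. by rewrite dotvC dotvZl dotvC. Qed.

Lemma vnormZ {k} (a : R) (x : 'rV[R]_k) : vnorm (a *: x) = `|a| * vnorm x.
Proof.
rewrite /vnorm -sqrtr_sqr -sqrtrM ?sqr_ge0//.
by rewrite mulr_sumr; congr Num.sqrt; apply: eq_bigr => l _; rewrite mxE exprMn.
Qed.

Lemma vnorm_eq0 {k} (x : 'rV[R]_k) : vnorm x = 0 -> x = 0.
Proof.
move=> x0; have := vnorm_sqr x; rewrite x0 expr0n /= => /esym/eqP.
rewrite psumr_eq0 => [/allP xl0|l _]; last by rewrite sqr_ge0.
apply/rowP => l; rewrite mxE.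
by apply/eqP; rewrite -sqrf_eq0; apply: (xl0 l); rewrite mem_index_enum.
Qed.

(** Expand the square of [|y|^2 x - <x,y> y], which is nonnegative, and cancel [|y|^2]; the case
    [y = 0] is separate. *)
Lemma cauchy_schwarz {k} (x y : 'rV[R]_k) : `|dotv x y| <= vnorm x * vnorm y.
Proof.
have [y0|yn0] := eqVneq (vnorm y) 0.
  rewrite y0 mulr0 (vnorm_eq0 _ y0) [dotv _ _]big1 ?normr0// => l _.
  by rewrite mxE mulr0.
have yp : 0 < vnorm y by rewrite lt_def yn0 vnorm_ge0.
rewrite -(@ler_pXn2r _ 2)// ?nnegrE ?mulr_ge0 ?vnorm_ge0// real_normK ?num_real//.
have := sqr_ge0 (vnorm (vnorm y ^+ 2 *: x + (- dotv x y) *: y)).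
rewrite -(dotvv (_ + _)) dotvDl !dotvDr !dotvZl !dotvZr !dotvv (dotvC y x) exprMn.
set a := vnorm x ^+ 2; set b := dotv _ _; set e := vnorm y => H.
have : 0 <= e ^+ 2 * (a * e ^+ 2 - b ^+ 2) by apply: le_trans H _; lra.
by rewrite pmulr_rge0 ?exprn_gt0// subr_ge0.
Qed.

Lemma vnorm_sqr_young {k} (e : R) (x y : 'rV[R]_k) : 0 < e ->
  vnorm (x + y) ^+ 2 <= (1 + e) * vnorm x ^+ 2 + (1 + e^-1) * vnorm y ^+ 2.
Proof.
move=> e0; rewrite !vnorm_sqr !mulr_sumr -big_split /=; apply: ler_sum => l _.
rewrite mxE; set a := x 0 l; set b := y 0 l; rewrite -subr_ge0.
rewrite (_ : _ - _ = e^-1 * (e * a - b) ^+ 2); last by field; rewrite gt_eqF.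
by rewrite mulr_ge0 ?sqr_ge0// invr_ge0 ltW.
Qed.

(** Scaling a nonzero [u] to unit length makes it a competitor in the supremum defining [opnorm]. *)
Lemma vnorm_mulmx_le_opnorm {m k} (A : 'M[R]_(m, k)) (u : 'rV[R]_k) :
  vnorm (A *m u^T)^T <= opnorm A * vnorm u.
Proof.
have Au (z : 'rV[R]_k) i : (A *m z^T)^T 0 i = dotv (row i A) z.
  by rewrite !mxE; apply: eq_bigr => l _; rewrite !mxE.
have ub : has_ubound
    [set vnorm (A *m u^T)^T | u in [set u : 'rV[R]_k | vnorm u <= 1]].
  (* A [sup] dominates its set only when that set is bounded; the Frobenius norm bounds it, by
     Cauchy-Schwarz on each row. *)
  exists (Num.sqrt (\sum_(i < m) vnorm (row i A) ^+ 2)) => _ [z /= z1 <-].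
  rewrite ler_sqrt ?sumr_ge0// => [|i _]; last by rewrite sqr_ge0.
  apply: ler_sum => i _; rewrite Au -[leLHS]real_normK ?num_real//.
  rewrite ler_pXn2r ?nnegrE ?vnorm_ge0//.
  apply: le_trans (cauchy_schwarz _ _) _.
  by rewrite ler_piMr// vnorm_ge0.
have [u0|un0] := eqVneq (vnorm u) 0.
  rewrite u0 mulr0 (vnorm_eq0 _ u0) trmx0 mulmx0 trmx0.
  by rewrite -[0](scale0r (0 : 'rV_m)) vnormZ normr0 mul0r.
have up : 0 < vnorm u by rewrite lt_def un0 vnorm_ge0.
rewrite -ler_pdivrMr//; apply: ub_le_sup => //.
exists ((vnorm u)^-1 *: u).
  by rewrite /= vnormZ gtr0_norm ?invr_gt0// mulVf.
rewrite linearZ /= -scalemxAr linearZ /= vnormZ gtr0_norm ?invr_gt0//.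
by rewrite mulrC.
Qed.

(** [opnorm] acts on columns while the Hessian acts on rows here; both readings give the same scalar
    [u A u^T]. *)
Lemma quadratic_form_le_opnorm {k} (A : 'M[R]_k) (u : 'rV[R]_k) :
  `|dotv (u *m A) u| <= opnorm A * vnorm u ^+ 2.
Proof.
have -> : dotv (u *m A) u = dotv u (A *m u^T)^T.
  transitivity ((u *m A *m u^T) 0 0); last rewrite -mulmxA.
    by rewrite mxE; apply: eq_bigr => l _; rewrite [u^T _ _]mxE.
  by rewrite mxE; apply: eq_bigr => l _; rewrite [in RHS]mxE.
apply: le_trans (cauchy_schwarz _ _) _.
rewrite expr2 mulrA mulrC ler_wpM2r ?vnorm_ge0//.
exact: vnorm_mulmx_le_opnorm.
Qed.

End Euclidean.

(** * Calculus along lines: Taylor bounds, convexity and smoothness *)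

Section Differential.
Context {R : realType}.
Implicit Types k : nat.

Lemma diff_dot_grad {k} (f : 'rV[R]_k -> R) x u : 'd f x u = dotv (grad f x) u.
Proof.
rewrite {1}(row_sum_delta u) linear_sum; apply: eq_bigr => l _.
by rewrite linearZ /= /grad mxE mulrC.
Qed.

Lemma is_diff_line {k} (x u : 'rV[R]_k) (s : R) :
  is_diff s (fun s : R => x + s *: u) (fun s : R => s *: u).
Proof. by apply: is_diff_eq; rewrite ?add0r. Qed.

Lemma is_derive_line {k} (f : 'rV[R]_k -> R) (x u : 'rV[R]_k) (s : R) :
  differentiable f (x + s *: u) ->
  is_derive s 1 (fun s => f (x + s *: u)) (dotv (grad f (x + s *: u)) u).
Proof.
move=> df.
have dl := is_diff_line x u s.
have dc : differentiable (f \o (fun s : R => x + s *: u)) s.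
  by apply: differentiable_comp.
apply: DeriveDef; first exact/diff_derivable.
rewrite deriveE// diff_comp//= diff_val/= scale1r.
exact: diff_dot_grad.
Qed.

Lemma is_derive_grad_line {k} (f : 'rV[R]_k -> R) (x u : 'rV[R]_k) (s : R) :
  differentiable (grad f) (x + s *: u) ->
  is_derive s 1 (fun s => dotv (grad f (x + s *: u)) u)
    (dotv (u *m hessian f (x + s *: u)) u).
Proof.
move=> df.
have dl := is_diff_line x u s.
set g := grad f \o (fun s : R => x + s *: u).
have dc : differentiable g s by apply: differentiable_comp.
have dm : derivable g s 1 by apply: diff_derivable.
have Dg : 'D_1 g s = u *m hessian f (x + s *: u).
  rewrite deriveE// diff_comp//= diff_val/= scale1r.
  by rewrite /hessian /jacobian mul_rV_lin1.
have Dl l : is_derive s 1 (fun s => g s 0 l * u 0 l)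
    ((u *m hessian f (x + s *: u)) 0 l * u 0 l).
  have gl := (derivable_mxP _ _ _).1 dm 0 l.
  apply: DeriveDef; first exact: derivableM.
  by rewrite deriveMr//= -Dg derive_mx// mxE mulrC.
rewrite [X in is_derive _ _ X](_ : _ = \sum_l (fun s => g s 0 l * u 0 l)).
  exact: is_derive_sum.
by apply/funext => r; rewrite fct_sumE.
Qed.

Lemma jacobian_compo {k m} (f : 'rV[R]_k -> 'rV[R]_m) j (x u : 'rV[R]_k) :
  differentiable f x -> differentiable (compo f j) x ->
  (u *m 'J f x) 0 j = dotv (grad (compo f j) x) u.
Proof.
move=> df dfj; rewrite -diff_dot_grad -deriveE// -deriveEjacobian//.
by rewrite derive_mx ?mxE//; exact: diff_derivable.
Qed.

(** The mean value theorem is used twice: on [g1], to get [g1 s - g1 0 <= M s], then on [g] minus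
    its comparison parabola, whose derivative is therefore nonpositive on the unit interval. *)
Lemma taylor2_le (g g1 g2 : R -> R) (M : R) :
  (forall s : R, is_derive s 1 g (g1 s)) -> (forall s : R, is_derive s 1 g1 (g2 s)) ->
  (forall s, g2 s <= M) -> g 1 - g 0 - g1 0 <= M / 2.
Proof.
move=> dg dg1 g2M.
have cont (p p1 : R -> R) (b : R) : (forall s : R, is_derive s 1 p (p1 s)) ->
    {within `[0, b], continuous p}.
  by move=> dp; apply: derivable_within_continuous => r _; case: (dp r).
have g1M (s : R) : 0 <= s -> g1 s - g1 0 <= M * s.
  move=> s0; have [r _ ->] := MVT_segment s0 (fun r _ => dg1 r) (cont _ _ _ dg1).
  by rewrite subr0 ler_wpM2r.
pose p (s : R) : R := g s - g1 0 * s - M / 2 * s ^+ 2.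
have dp (s : R) : is_derive s 1 p (g1 s - g1 0 - M * s).
  by apply: is_derive_eq; rewrite ![_%:A]mulr1 [_ *: _]mulrC; lra.
have [r r01] := MVT_segment ler01 (fun r _ => dp r) (cont _ _ _ dp).
have : g1 r - g1 0 <= M * r by apply: g1M; move: r01; rewrite in_itv/= => /andP[].
rewrite /p; lra.
Qed.

Lemma taylor2_abs_le (g g1 g2 : R -> R) (M : R) :
  (forall s : R, is_derive s 1 g (g1 s)) -> (forall s : R, is_derive s 1 g1 (g2 s)) ->
  (forall s, `|g2 s| <= M) -> `|g 1 - g 0 - g1 0| <= M / 2.
Proof.
move=> dg dg1 g2M; rewrite ler_norml; apply/andP; split; last first.
  by apply: (taylor2_le _ _ _ _ dg dg1) => s; apply: le_trans (g2M s); exact: ler_norm.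
suff : - g 1 - - g 0 - - g1 0 <= M / 2 by lra.
apply: (taylor2_le (- g) (- g1) (- g2)) => // s /=.
by apply: le_trans (g2M s); rewrite -normrN; exact: ler_norm.
Qed.

Lemma taylor2_hessian_bound {k} (f : 'rV[R]_k -> R) (G : R) (x u : 'rV[R]_k) :
  (forall y, differentiable f y) -> (forall y, differentiable (grad f) y) ->
  (forall y, opnorm (hessian f y) <= G) ->
  `|f (x + u) - f x - dotv (grad f x) u| <= G * vnorm u ^+ 2 / 2.
Proof.
move=> df dg hG.
have := taylor2_abs_le (fun s => f (x + s *: u))
  (fun s => dotv (grad f (x + s *: u)) u)
  (fun s => dotv (u *m hessian f (x + s *: u)) u) (G * vnorm u ^+ 2).
rewrite scale1r scale0r addr0; apply => s.
- exact: is_derive_line.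
- exact: is_derive_grad_line.
- by apply: le_trans (quadratic_form_le_opnorm _ _) _; rewrite ler_wpM2r ?sqr_ge0.
Qed.

(** Convexity bounds the difference quotients from [x] towards [y], for steps in (0,1], by
    [f y - f x]; their limit at 0 from the right is the directional derivative. *)
Lemma convex_grad_le {k} (f : 'rV[R]_k -> R) (x y : 'rV[R]_k) :
  convex_fun f -> differentiable f x ->
  f x + dotv (grad f x) (y - x) <= f y.
Proof.
move=> cf df; set u := y - x.
have := is_derive_line f x u 0; rewrite scale0r addr0 => /(_ df).
set g := fun s => _ => -[dg Dg].
rewrite -lerBrDl -Dg ['D_1 g 0]cvg_at_rightE//; apply: limr_le.
  (* The right-hand limit exists because the two-sided one does. *)
  rewrite -(cvg_at_rightE (fun h : R => h^-1 *: ((g \o shift 0) _ - g 0))) //.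
  apply: cvg_trans dg; apply: cvg_app.
  move=> A [e egt0 Ae]; exists e => // r re rgt0; apply: Ae => //.
  exact/lt0r_neq0.
near=> s; have s0 : 0 < s by near: s; exact: nbhs_right_gt.
have s1 : s <= 1 by near: s; exact: nbhs_right_le.
rewrite /= addr0 [_%:A]mulr1 /g scale0r addr0 [_ *: _]mulrC ler_pdivrMr//.
have := cf y x s; rewrite (ltW s0) s1 => /(_ isT).
have -> : s *: y + (1 - s) *: x = x + s *: u.
  by rewrite scalerBr scalerBl scale1r addrCA.
lra.
Unshelve. all: by end_near. Qed.

Lemma convex_smooth_grad_le {k} (f : 'rV[R]_k -> R) (L : R) (x z : 'rV[R]_k) :
  0 < L -> convex_fun f -> smooth L f -> (forall y, f z <= f y) ->
  vnorm (grad f x) ^+ 2 <= 4 * L * (f x - f z).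
Proof.
move=> L0 cf [df lf] fz; set g := grad f x; pose s := (2 * L)^-1.
have s0 : 0 < s by rewrite invr_gt0 mulr_gt0.
(* Apply the first-order convexity inequality at [y], the gradient step of
   length [s] from [x]. *)
pose y := x - s *: g.
have := convex_grad_le f y x cf (df y).
have -> : x - y = s *: g by rewrite /y opprB addrC subrK.
rewrite dotvZr (_ : grad f y = g + (grad f y - g)); last by rewrite addrC subrK.
rewrite dotvDl dotvv => H.
have : `|dotv (grad f y - g) g| <= L * s * vnorm g ^+ 2.
  apply: le_trans (cauchy_schwarz _ _) _.
  rewrite expr2 !mulrA ler_wpM2r ?vnorm_ge0//.
  apply: le_trans (lf y x) _.
  by rewrite /y addrC addrA addNr add0r -scaleNr vnormZ normrN gtr0_norm// mulrA.
(* With [s = 1/(2L)] the gradient at [y] keeps at least half of its component along [g], so [f]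
   drops by at least [s |g|^2 / 2] from [x] to [y]. *)
have -> : L * s = 2^-1 by rewrite /s; field; rewrite gt_eqF.
move=> /ler_normlP[H2 _].
have H3 : s * (vnorm g ^+ 2 / 2) <= f x - f z.
  have : s * (- (2^-1 * vnorm g ^+ 2)) <= s * dotv (grad f y - g) g.
    by rewrite ler_wpM2l ?(ltW s0)// lerNl.
  by have := fz y; lra.
rewrite (_ : vnorm g ^+ 2 = 4 * L * (s * (vnorm g ^+ 2 / 2))).
  by rewrite ler_pM2l// mulr_gt0.
by rewrite /s; field; rewrite gt_eqF.
Qed.

End Differential.

(** * One-step estimates and the telescoping recursion *)

Section Descent.
Context {R : realType}.

(** Each of the [m] components obeys the same scalar Taylor bound; summing their squares gives the
    factor [m]. *)
Lemma linearization_residual {k m} (f : 'rV[R]_k -> 'rV[R]_m) (G : R) x u :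
  C2 f -> (forall j y, opnorm (hessian (compo f j) y) <= G) ->
  vnorm (f (x + u) - f x - u *m 'J f x) ^+ 2
  <= m%:R * (G * vnorm u ^+ 2 / 2) ^+ 2.
Proof.
move=> [df dc] hG; rewrite vnorm_sqr.
apply: (@le_trans _ _ (\sum_(j < m) (G * vnorm u ^+ 2 / 2) ^+ 2)); last first.
  by rewrite sumr_const card_ord mulr_natl.
apply: ler_sum => j _; have [dfj [dgj _]] := dc j.
rewrite -[leLHS]real_normK ?num_real//.
have H : `|(f (x + u) - f x - u *m 'J f x) 0 j| <= G * vnorm u ^+ 2 / 2.
  have := taylor2_hessian_bound (compo f j) G x u dfj dgj (hG j).
  rewrite -jacobian_compo// /compo; set J := u *m 'J f x.
  by rewrite !mxE.
by rewrite ler_pXn2r// nnegrE; exact: le_trans (normr_ge0 _) H.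
Qed.

(** Young's inequality splits off [e]. In the square of the exact step, convexity makes the cross
    term at most [-2a] times the gap, and the quadratic term is at most [4 L a^2], hence
    [4 alpha a], times the gap. *)
Lemma perturbed_gradient_step {k} (f : 'rV[R]_k -> R) (L eps a alpha : R)
    (x z e : 'rV[R]_k) :
  0 < L -> 0 < eps -> 0 <= a -> L * a <= alpha ->
  convex_fun f -> smooth L f -> (forall y, f z <= f y) ->
  vnorm (x - a *: grad f x + e - z) ^+ 2
  <= (1 + eps) * (vnorm (x - z) ^+ 2 - 2 * a * (1 - 2 * alpha) * (f x - f z))
     + (1 + eps^-1) * vnorm e ^+ 2.
Proof.
move=> L0 eps0 a0 La cf sf fz; have [df _] := sf; set g := grad f x.
have -> : x - a *: g + e - z = (x - z + (- a) *: g) + e.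
  by rewrite scaleNr addrAC [x - z - _]addrAC.
apply: le_trans (vnorm_sqr_young eps _ _ eps0) _.
rewrite lerD2r ler_wpM2l ?addr_ge0 ?(ltW eps0)//.
have gfz : dotv g (x - z) >= f x - f z.
  have := convex_grad_le f x z cf (df x).
  by rewrite -opprB -scaleN1r dotvZr -/g; lra.
move: gfz; move: (x - z) => y gfz.
rewrite -(dotvv (_ + _)) dotvDl !dotvDr !dotvZl !dotvZr !dotvv (dotvC y g).
have ga : a * (a * vnorm g ^+ 2) <= a * (4 * alpha * (f x - f z)).
  rewrite ler_wpM2l//.
  apply: (@le_trans _ _ (a * (4 * L * (f x - f z)))).
    by rewrite ler_wpM2l//; exact: convex_smooth_grad_le.
  rewrite (_ : _ * _ = 4 * (L * a) * (f x - f z)); last by ring.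
  by rewrite ler_wpM2r ?subr_ge0// ler_wpM2l.
have : a * (f x - f z) <= a * dotv g y by rewrite ler_wpM2l.
lra.
Qed.

(** Divided by [(1 + e) ^+ t], the recursion telescopes: the weight in front of [Dl t] cancels, and
    each step adds at most [C]. *)
Lemma geometric_telescope (P Dl : nat -> R) (e K C : R) (T : nat) :
  0 <= e -> 0 <= C ->
  (forall t, (t < T)%N ->
    P t.+1 <= (1 + e) * (P t - (1 + e) ^+ t * K * Dl t) + (1 + e) * C) ->
  0 <= P T -> K * \sum_(t < T) Dl t <= P 0 + T%:R * C.
Proof.
move=> e0 C0 step PT.
have q0 t : 0 < (1 + e) ^+ t by rewrite exprn_gt0// ltr_wpDr.
suff : P T + (1 + e) ^+ T * (K * \sum_(t < T) Dl t)
       <= (1 + e) ^+ T * (P 0 + T%:R * C).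
  by move=> H; rewrite -(ler_pM2l (q0 T)); apply: le_trans H; rewrite lerDr.
(* The strengthened claim keeps the term [P T], and [PT] is dropped because nonnegativity is given
   at the final index only. *)
elim: T step {PT} => [|T IH] step.
  by rewrite big_ord0 mulr0 mulr0 mul0r !addr0 expr0 mul1r.
have {}IH := IH (fun t tT => step t (ltnW tT)).
have := step T (ltnSn T); rewrite big_ord_recr /= -natr1 exprS.
set q := (1 + e) ^+ T in IH *; set S := \sum_(t < T) _ in IH *.
have q1 : 1 <= q by rewrite exprn_ege1// lerDl.
have : (1 + e) * (P T + q * (K * S)) <= (1 + e) * (q * (P 0 + T%:R * C)).
  by rewrite ler_wpM2l// addr_ge0.
(* The additive error is inflated by [q >= 1] to carry the same power of [1 + e] as the other
   terms. *)
have : (1 + e) * C * 1 <= (1 + e) * C * q.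
  by rewrite ler_wpM2l// mulr_ge0// addr_ge0.
lra.
Qed.

End Descent.

(** * Estimates for the regularized least-squares direction *)

Section Algorithm.
Context {R : realType} {n c d : nat}.
Context (h : 'I_n -> 'rV[R]_d -> 'rV[R]_c) (phi : 'I_n -> 'rV[R]_c -> R).

Lemma Phi_ge0 eta alf w u : 0 <= Phi h phi eta alf w u.
Proof.
rewrite mulr_ge0 ?invr_ge0 ?mulr_ge0// sumr_ge0// => i _.
by rewrite sqr_ge0.
Qed.

(** The comparison gives [Psi u <= eps^2 + eps^2 V / 2]; dropping either nonnegative term of [Psi u]
    bounds the other. *)
Lemma regularized_minimizer_bounds (eps V eta : R) alf w u uh :
  0 < eps -> vnorm uh ^+ 2 <= V -> Phi h phi eta alf w uh <= eps ^+ 2 ->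
  Psi h phi eta alf w eps u <= Psi h phi eta alf w eps uh ->
  vnorm u ^+ 2 <= V + 2 /\ 2 * Phi h phi eta alf w u <= eps ^+ 2 * (V + 2).
Proof.
move=> eps0 uhV Phih; rewrite /Psi => le_Psi.
have e2 : 0 < eps ^+ 2 by rewrite exprn_gt0.
have le_uh : eps ^+ 2 * vnorm uh ^+ 2 <= eps ^+ 2 * V by rewrite ler_pM2l.
have u0 : 0 <= eps ^+ 2 * vnorm u ^+ 2 by rewrite mulr_ge0 ?sqr_ge0.
have := Phi_ge0 eta alf w u.
split; last by lra.
by rewrite -(ler_pM2l e2); lra.
Qed.

(** The deviation is the least-squares residual, whose mean square is [2 Phi], plus the Taylor
    residual of [h i]. Since [eta^2] is proportional to [eps], the latter has norm of order
    [eps]. *)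
Lemma average_linearization_error (G V eps eta D a : R) w u :
  (0 < n)%N -> (forall i, C2 (h i)) -> 0 <= G ->
  (forall i (j : 'I_c) x, opnorm (hessian (compo (h i) j) x) <= G) ->
  0 <= eps -> eta ^+ 2 = D ^+ 2 * eps -> 0 <= V -> vnorm u ^+ 2 <= V + 2 ->
  2 * Phi h phi eta (fun=> a) w u <= eps ^+ 2 * (V + 2) ->
  n%:R^-1 * \sum_(i < n)
    vnorm (h i (w - eta *: u) - (h i w - a *: grad (phi i) (h i w))) ^+ 2
  <= eps ^+ 2 / 2 * (c%:R * ((V + 2) * G * D ^+ 2) ^+ 2 + 8 + 4 * V).
Proof.
move=> n0 hC2 G0 hG eps0 etaE V0 uV.
pose J i := eta *: (u *m 'J (h i) w) - a *: grad (phi i) (h i w).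
rewrite -[Phi _ _ _ _ _ _]/((2 * n%:R)^-1 * \sum_(i < n) vnorm (J i) ^+ 2) => PhiV.
have nR : 0 < n%:R :> R by rewrite ltr0n.
pose r := c%:R * (eps * ((V + 2) * G * D ^+ 2) / 2) ^+ 2.
have step i : vnorm (h i (w - eta *: u)
    - (h i w - a *: grad (phi i) (h i w))) ^+ 2 <= 2 * vnorm (J i) ^+ 2 + 2 * r.
  (* The displacement is [- eta u], so the residual [J i] enters with a minus sign. *)
  pose q := h i (w + - (eta *: u)) - h i w - (- (eta *: u)) *m 'J (h i) w.
  have -> : h i (w - eta *: u) - (h i w - a *: grad (phi i) (h i w))
      = (- 1) *: J i + q.
    rewrite scaleN1r /q /J mulNmx -scalemxAl opprK opprB opprB.
    by rewrite [RHS]addrC -addrA subrKC addrCA addrC -!addrA [_ + (- _)]addrC addrA.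
  apply: le_trans (vnorm_sqr_young 1 _ _ ltr01) _.
  rewrite vnormZ normrN normr1 mul1r invr1 lerD2l ler_wpM2l//.
  apply: le_trans (linearization_residual (h i) G _ _ (hC2 i) (hG i)) _.
  rewrite ler_wpM2l// -scaleNr vnormZ normrN [(`|_| * _) ^+ 2]exprMn real_normK ?num_real// etaE.
  have s0 : 0 <= G * (D ^+ 2 * eps) by rewrite mulr_ge0// mulr_ge0// sqr_ge0.
  rewrite (_ : eps * _ = G * (D ^+ 2 * eps) * (V + 2)); last by ring.
  have le_s : G * (D ^+ 2 * eps * vnorm u ^+ 2) / 2
      <= G * (D ^+ 2 * eps) * (V + 2) / 2.
    by rewrite ler_wpM2r// mulrA ler_wpM2l.
  have ge_s : 0 <= G * (D ^+ 2 * eps * vnorm u ^+ 2) / 2.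
    by rewrite divr_ge0// mulrA mulr_ge0// sqr_ge0.
  by rewrite ler_pXn2r ?nnegrE// (le_trans ge_s).
apply: (@le_trans _ _ (n%:R^-1 * \sum_(i < n) (2 * vnorm (J i) ^+ 2 + 2 * r))).
  by rewrite ler_wpM2l ?invr_ge0// ler_sum.
rewrite big_split /= -mulr_sumr sumr_const card_ord -[2 * r *+ n]mulr_natl.
set S := \sum_(i < n) _ in PhiV *.
have -> : n%:R^-1 * (2 * S + n%:R * (2 * r))
    = 2 * (2 * ((2 * n%:R)^-1 * S)) + 2 * r.
  by field; rewrite gt_eqF.
rewrite /r; lra.
Qed.

(** The mean of the separate minima of the [phi i] is a lower bound of [Fobj], hence of its
    infimum. *)
Lemma Fobj_sub_Fstar_le hstar w :
  (forall i z, phi i (hstar i) <= phi i z) ->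
  Fobj h phi w - Fstar h phi
  <= n%:R^-1 * \sum_(i < n) (phi i (h i w) - phi i (hstar i)).
Proof.
move=> hmin; rewrite sumrB mulrBr lerB//; apply: lb_le_inf.
  by exists (Fobj h phi w), w.
by move=> _ [y _ <-]; rewrite ler_wpM2l ?invr_ge0// ler_sum.
Qed.

End Algorithm.

(** * Assembly of the convergence rate *)

Theorem theorem1 (R : realType) (n c d : nat)
  (h : 'I_n -> 'rV[R]_d -> 'rV[R]_c) (phi : 'I_n -> 'rV[R]_c -> R)
  (hstar : 'I_n -> 'rV[R]_c)
  (Lphi G V eps beta D alpha : R) (T : nat)
  (w v : nat -> 'rV[R]_d) :
  (0 < n)%N -> (0 < c)%N -> (0 < d)%N ->
  0 < Lphi -> 0 < G -> 0 < V -> 0 < eps -> 0 < beta -> 0 < D ->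
  0 < alpha -> alpha < 3^-1 ->
  T%:R = beta / eps ->
  (* each phi_i attains its minimum at hstar i *)
  (forall i z, phi i (hstar i) <= phi i z) ->
  (* Assumption A *)
  (forall i, convex_fun (phi i) /\ bounded_below (phi i) /\ smooth Lphi (phi i)) ->
  (* Assumption B *)
  (forall i, C2 (h i)) ->
  (forall i (j : 'I_c) x, opnorm (hessian (compo (h i) j) x) <= G) ->
  (* Assumption C *)
  (forall t, (t < T)%N -> exists vh : 'rV[R]_d,
      vnorm vh ^+ 2 <= V /\
      Phi h phi (D * Num.sqrt eps)
        (fun _ => (1 + eps) ^+ t * (alpha / (expR beta * Lphi))) (w t) vh
      <= eps ^+ 2) ->
  (* Algorithm 1 *)
  (forall t, (t < T)%N ->
      (forall u, Psi h phi (D * Num.sqrt eps)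
                   (fun _ => (1 + eps) ^+ t * (alpha / (expR beta * Lphi))) (w t) eps (v t)
                 <= Psi h phi (D * Num.sqrt eps)
                   (fun _ => (1 + eps) ^+ t * (alpha / (expR beta * Lphi))) (w t) eps u) /\
      w t.+1 = w t - (D * Num.sqrt eps) *: v t) ->
  T%:R^-1 * \sum_(t < T) (Fobj h phi (w t) - Fstar h phi)
  <= expR beta * Lphi * (1 + eps) / (2 * (1 - 3 * alpha) * alpha * beta)
       * (n%:R^-1 * \sum_(i < n) vnorm (h i (w 0%N) - hstar i) ^+ 2) * eps
   + expR beta * Lphi * (3 * eps + 2) / (8 * alpha * (1 - 3 * alpha))
       * (c%:R * (4 + (V + 2) * G * D ^+ 2) ^+ 2 + 8 + 4 * V) * eps.
Proof.
move=> n0 c0 d0 L0 G0 V0 eps0 beta0 D0 alpha0 alpha3 TE hmin hA hB hG hC hAlg.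
have nR : 0 < n%:R :> R by rewrite ltr0n.
have Q0 : 0 < expR beta * Lphi by rewrite mulr_gt0 ?expR_gt0.
set a0 := alpha / (expR beta * Lphi) in hC hAlg.
have a00 : 0 < a0 by rewrite divr_gt0.
set B := (c%:R * (4 + (V + 2) * G * D ^+ 2) ^+ 2 + 8 + 4 * V).
(* The error estimate produces [B'], without the 4 inside the square; it is enlarged to [B] at the
   very end. *)
pose B' := (c%:R * ((V + 2) * G * D ^+ 2) ^+ 2 + 8 + 4 * V).
have X0 : 0 <= (V + 2) * G * D ^+ 2.
  by rewrite mulr_ge0 ?sqr_ge0// mulr_ge0 ?addr_ge0// ?(ltW V0) ?(ltW G0).
have B'0 : 0 <= B'.
  by rewrite !addr_ge0// mulr_ge0// ?sqr_ge0 ?(ltW V0).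
have B'B : B' <= B.
  by rewrite !lerD2r ler_wpM2l// ler_pXn2r ?nnegrE ?addr_ge0// lerDr.
pose P t := n%:R^-1 * \sum_(i < n) vnorm (h i (w t) - hstar i) ^+ 2.
pose Dl t := n%:R^-1 * \sum_(i < n) (phi i (h i (w t)) - phi i (hstar i)).
have P0 t : 0 <= P t.
  by rewrite mulr_ge0 ?invr_ge0// sumr_ge0// => i _; rewrite sqr_ge0.
pose K := 2 * (1 - 2 * alpha) * a0.
(* [(1 + eps)^t <= e^(eps T) = e^beta]: the growing rates keep [Lphi * a <= alpha], which is why
   [e^beta] divides the initial rate. *)
have powT t : (t < T)%N -> (1 + eps) ^+ t <= expR beta.
  move=> tT; apply: (@le_trans _ _ (expR eps ^+ t)).
    by rewrite lerXn2r ?nnegrE ?addr_ge0 ?expR_ge0 ?(ltW eps0)// expR_ge1Dx.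
  rewrite -expRM_natl ler_expR.
  have -> : beta = eps * T%:R by rewrite TE; field; rewrite gt_eqF.
  by rewrite mulrC ler_wpM2l ?(ltW eps0)// ler_nat ltnW.
have step t : (t < T)%N -> P t.+1 <=
    (1 + eps) * (P t - (1 + eps) ^+ t * K * Dl t) + (1 + eps) * (eps * B' / 2).
  move=> tT; have [uh [uhV uhPhi]] := hC t tT; have [vmin wE] := hAlg t tT.
  set a := (1 + eps) ^+ t * a0 in uhPhi vmin *.
  have [vV PhiV] := regularized_minimizer_bounds _ _ _ _ _ _ _ _ _ eps0 uhV uhPhi (vmin uh).
  have eta2 : (D * Num.sqrt eps) ^+ 2 = D ^+ 2 * eps.
    by rewrite exprMn sqr_sqrtr// ltW.
  have := average_linearization_error h phi G V eps _ D a _ _ n0 hB (ltW G0) hG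
    (ltW eps0) eta2 (ltW V0) vV PhiV.
  rewrite -/B' -wE.
  set e := fun i => h i (w t.+1) - (h i (w t) - a *: grad (phi i) (h i (w t))).
  move=> eB.
  have age0 : 0 <= a by rewrite mulr_ge0 ?(ltW a00)// exprn_ge0// addr_ge0 ?(ltW eps0).
  have La : Lphi * a <= alpha.
    have -> : alpha = Lphi * (expR beta * a0).
      by rewrite /a0; field; rewrite !gt_eqF ?expR_gt0.
    by rewrite ler_pM2l// ler_pM2r// powT.
  have stepi i : vnorm (h i (w t.+1) - hstar i) ^+ 2 <=
      (1 + eps) * vnorm (h i (w t) - hstar i) ^+ 2
      - (1 + eps) * (2 * a * (1 - 2 * alpha)) * (phi i (h i (w t)) - phi i (hstar i))
      + (1 + eps^-1) * vnorm (e i) ^+ 2.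
    have [cf [_ sf]] := hA i.
    have := perturbed_gradient_step (phi i) Lphi eps a alpha (h i (w t))
      (hstar i) (e i) L0 eps0 age0 La cf sf (hmin i).
    rewrite [h i (w t) - _ + e i]addrC /e subrK; lra.
  have : P t.+1 <= (1 + eps) * P t - (1 + eps) * (2 * a * (1 - 2 * alpha)) * Dl t
      + (1 + eps^-1) * (n%:R^-1 * \sum_(i < n) vnorm (e i) ^+ 2).
    rewrite /P /Dl ![_ * (n%:R^-1 * _)]mulrCA -mulrBr -mulrDr.
    rewrite ler_wpM2l ?invr_ge0//.
    rewrite !mulr_sumr -sumrB -big_split /=.
    by apply: ler_sum => i _; exact: stepi.
  have : (1 + eps^-1) * (n%:R^-1 * \sum_(i < n) vnorm (e i) ^+ 2)
      <= (1 + eps^-1) * (eps ^+ 2 / 2 * B').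
    by rewrite ler_wpM2l// addr_ge0 ?invr_ge0 ?(ltW eps0).
  (* Young's factor [1 + 1/eps] costs one power of [eps], and a factor [1 + eps] comes out as the
     telescoping lemma requires. *)
  have -> : (1 + eps^-1) * (eps ^+ 2 / 2 * B') = (1 + eps) * (eps * B' / 2).
    by field; rewrite gt_eqF.
  rewrite /K /a; lra.
have T0 : 0 < T%:R :> R by rewrite TE divr_gt0.
have C0 : 0 <= eps * B' / 2 by rewrite !mulr_ge0 ?(ltW eps0).
have := geometric_telescope P Dl _ _ _ T (ltW eps0) C0 step (P0 T).
set S := \sum_(t < T) Dl t => KS.
have a2 : 0 < 1 - 2 * alpha by lra.
have a3 : 0 < 1 - 3 * alpha by lra.
have K0 : 0 < K by rewrite mulr_gt0// mulr_gt0.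
have FS : T%:R^-1 * \sum_(t < T) (Fobj h phi (w t) - Fstar h phi) <= T%:R^-1 * S.
  rewrite ler_wpM2l ?invr_ge0 ?(ltW T0)//; apply: ler_sum => t _.
  exact: Fobj_sub_Fstar_le.
apply: le_trans FS _; rewrite -[n%:R^-1 * _]/(P 0).
apply: (@le_trans _ _ (T%:R^-1 * ((P 0 + T%:R * (eps * B' / 2)) / K))).
  by rewrite ler_wpM2l ?invr_ge0 ?(ltW T0)// ler_pdivlMr// mulrC.
have inv23 : (1 - 2 * alpha)^-1 <= (1 - 3 * alpha)^-1.
  by rewrite lef_pV2 ?posrE//; lra.
set Q := expR beta * Lphi in Q0 *.
(* [1/T] becomes [eps / beta], and dividing by [K] brings in [Q / alpha]. *)
have -> : T%:R^-1 * ((P 0 + T%:R * (eps * B' / 2)) / K)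
    = Q / (2 * alpha * beta) * P 0 * eps * (1 - 2 * alpha)^-1
      + Q / (4 * alpha) * B' * eps * (1 - 2 * alpha)^-1.
  by rewrite /K /a0 -/Q TE; field; rewrite !gt_eqF.
(* Both target terms are put in matching form. Their extra factors [1 + eps] and [1 + 3/2 eps] are
   at least 1, so [inv23] and [B'B] finish the comparison. *)
have -> : Q * (1 + eps) / (2 * (1 - 3 * alpha) * alpha * beta) * P 0 * eps
    = Q / (2 * alpha * beta) * P 0 * eps * ((1 + eps) * (1 - 3 * alpha)^-1).
  by field; rewrite !gt_eqF.
have -> : Q * (3 * eps + 2) / (8 * alpha * (1 - 3 * alpha)) * B * eps
    = Q / (4 * alpha) * B * eps * ((1 + 3 / 2 * eps) * (1 - 3 * alpha)^-1).
  by field; rewrite !gt_eqF.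
have i3 : 0 < (1 - 3 * alpha)^-1 by rewrite invr_gt0.
have e3 : 0 < eps * (1 - 3 * alpha)^-1 by rewrite mulr_gt0.
have Qab : 0 <= Q / (2 * alpha * beta) * P 0 * eps.
  rewrite mulr_ge0 ?(ltW eps0)// mulr_ge0// divr_ge0 ?(ltW Q0)//.
  by rewrite mulr_ge0 ?(ltW beta0)// mulr_ge0// ltW.
have Qa : 0 <= Q / (4 * alpha).
  by rewrite divr_ge0 ?(ltW Q0)// mulr_ge0// ltW.
apply: lerD; first by rewrite ler_wpM2l//; lra.
apply: ler_pM; rewrite ?invr_ge0 ?(ltW a2)//; last by lra.
  by rewrite mulr_ge0 ?(ltW eps0)// mulr_ge0.
by rewrite ler_wpM2r ?(ltW eps0)// ler_wpM2l.
Qed.
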